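(* If a line arrangement $\mathcal A'$ in $\mathbb P^2$, consisting of $d'$ lines and having maximal multiplicity $m'$ of an intersection point, satisfies $2m'\ge d'$, then $r(\mathcal A')$ is determined by the weak combinatorics of $\mathcal A'$. That is, if $\mathcal A'_1$ and $\mathcal A'_2$ are two (essential) line arrangements in $\mathbb P^2$ with the same weak combinatorics and such that $2m'\ge d'$ for their common number of lines $d'$ and common maximal multiplicity $m'$, then $r(\mathcal A'_1)=r(\mathcal A'_2)$.
   Context: $\mathbb K$ is a field of characteristic zero, $S=\mathbb K[x,y,z]$ with the standard grading. A line arrangement $\mathcal A$ in $\mathbb P^2=\mathbb P^2_{\mathbb K}$ is a finite set of distinct lines, given by $f=0$ with $f\in S$ a product of pairwise non-proportional linear forms; it is essential if the lines do not all pass through one point. $r(\mathcal A)$ is the minimal degree $r$ for which there is a nonzero triple $(a,b,c)\in S_r^3$ with $af_x+bf_y+cf_z=0$. The multiplicity of a point is the number of lines of $\mathcal A$ through it; intersection points are the points of multiplicity $\ge 2$. The weak combinatorics of $\mathcal A$ is the collection of numbers $n_j$, $j\ge 2$, where $n_j$ is the number of points of $\mathcal A$ of multiplicity $j$ (these determine the number of lines and the maximal multiplicity). *)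

(* Defs.v *)
From HB Require Import structures.
From mathcomp Require Import all_boot all_order all_algebra.
From mathcomp Require Import boolp mpoly.

Set Implicit Arguments.
Unset Strict Implicit.
Unset Printing Implicit Defensive.

Import GRing.Theory.
Local Open Scope ring_scope.

(* The variables x, y, z of K[x, y, z] are 'X_0, 'X_1, 'X_2 in {mpoly K[3]}. *)

Section Arrangements.
Variable K : fieldType.

(* P^2 is the set of one-dimensional subspaces of K^3. *)
Record point := Point {
  point_space :> {vspace 'rV[K]_3};
  _ : \dim point_space == 1%N }.

HB.instance Definition _ := [isSub for point_space].
HB.instance Definition _ := [Choice of point by <:].

(* The arrangement is the set of lines [form i = 0]; it does not depend on the
   scaling or on the order of the forms, and zero or one line is allowed. *)
Record arrangement := Arrangement {
  nlines : nat;
  form : 'I_nlines -> {mpoly K[3]};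
  form_neq0 : forall i, form i != 0;
  form_homog : forall i, form i \is 1.-homog;
  form_nonprop : forall i j c, i != j -> form i <> c *: form j }.

Arguments form : clear implicits.

(* [linfun] only has its expected meaning on linear maps; evaluation of a
   linear form is one, see [mem_zeros]. *)
Definition zeros (l : {mpoly K[3]}) : {vspace 'rV[K]_3} :=
  lker (linfun (fun v : 'rV[K]_3 => l.@[v 0] : K^o)).

Definition on_line (P : point) (l : {mpoly K[3]}) : bool :=
  (P <= zeros l)%VS.

Section Combinatorics.
Variable A : arrangement.

Definition mult (P : point) : nat := #|[set i | on_line P (form A i)]|.

Definition essential : Prop :=
  ~ exists P : point, forall i, on_line P (form A i).

(* All the points (zeros l :&: zeros m) where l and m are forms of A such that
   this subspace has dimension 1; see [mem_intersection_points]. *)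
Definition intersection_points : seq point :=
  undup (pmap insub
    [seq (zeros (form A i) :&: zeros (form A j))%VS
       | i <- enum 'I_(nlines A), j <- enum 'I_(nlines A)]).

Definition npoints (j : nat) : nat :=
  count (fun P => mult P == j) intersection_points.

Definition max_mult : nat := \max_(P <- intersection_points) mult P.

End Combinatorics.

Definition same_weak_combinatorics (A B : arrangement) : Prop :=
  forall j, (2 <= j)%N -> npoints A j = npoints B j.

Definition defining_poly (A : arrangement) : {mpoly K[3]} :=
  \prod_(i < nlines A) form A i.

Definition has_syzygy (f : {mpoly K[3]}) (r : nat) : Prop :=
  exists a b c : {mpoly K[3]},
    [/\ [/\ a \is r.-homog, b \is r.-homog & c \is r.-homog],
        ~ [/\ a = 0, b = 0 & c = 0] &
        a * f^`M(0) + b * f^`M(1) + c * f^`M(2) = 0].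

Lemma zeros_linear (l : {mpoly K[3]}) : l \is 1.-homog ->
  linear (fun v : 'rV[K]_3 => l.@[v 0] : K^o).
Proof.
move=> /dhomogP hl a u v; rewrite !mevalE scaler_sumr -big_split /=.
apply: eq_big_seq => m /hl /eqP; rewrite mdeg_eq1 => /existsP[i /eqP ->].
have prodU (w : 'rV[K]_3) : \prod_j w 0 j ^+ U_(i)%MM j = w 0 i.
  rewrite (bigD1 i) //= mnm1E eqxx expr1 big1 ?mulr1 // => j ji.
  by rewrite mnm1E eq_sym (negPf ji) expr0.
by rewrite !prodU !mxE mulrDr /GRing.scale /= mulrCA.
Qed.

Lemma mem_zeros (l : {mpoly K[3]}) (v : 'rV[K]_3) : l \is 1.-homog ->
  (v \in zeros l) = (l.@[v 0] == 0).
Proof.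
move=> hl; rewrite memv_ker.
pose flin := GRing.isLinear.Build _ _ _ _ _ (zeros_linear hl).
pose f : {linear 'rV[K]_3 -> K^o} := HB.pack (fun v : 'rV[K]_3 => l.@[v 0] : K^o) flin.
by rewrite (lfunE f).
Qed.

Lemma zeros_full (l : {mpoly K[3]}) : l \is 1.-homog ->
  zeros l = fullv -> l = 0.
Proof.
move=> hl lT; apply/mpolyP => m; rewrite mcoeff0; apply/eqP/negPn/negP.
rewrite -mcoeff_msupp => lm; have := dhomog_mf hl lm => /eqP.
rewrite mdeg_eq1 => /existsP[i /eqP mi]; move: lm; rewrite mcoeff_msupp.
have := memvf (delta_mx 0 i : 'rV[K]_3); rewrite -lT mem_zeros // mevalE.
rewrite (bigID (pred1 m)) /= [X in _ + X]big_seq_cond [X in _ + X]big1.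
  rewrite -big_filter => + lm; rewrite filter_pred1_uniq ?msupp_uniq //.
    rewrite big_seq1 addr0 mi (bigD1 i) //= big1 ?mulr1.
      by rewrite mnm1E eqxx mxE !eqxx expr1 mulr1 -mi (negPf lm).
    by move=> j ji; rewrite mnm1E eq_sym (negPf ji) expr0.
  by rewrite mcoeff_msupp.
move=> m' /andP[/(dhomog_mf hl) /eqP]; rewrite mdeg_eq1 => /existsP[j /eqP m'j].
rewrite mi m'j => /negP ij; rewrite (bigD1 j) //= mnm1E eqxx mxE eqxx expr1 /=.
have /negPf -> : j != i by apply/eqP => ji; apply: ij; rewrite ji.
by rewrite mul0r mulr0.
Qed.

Lemma dim_zeros (l : {mpoly K[3]}) : l \is 1.-homog -> l != 0 ->
  \dim (zeros l) = 2%N.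
Proof.
move=> hl l0; rewrite /zeros; set g := linfun _.
have := limg_ker_dim g fullv; rewrite capfv dimvf /dim /= mul1n.
have : (\dim (limg g) <= 1)%N by rewrite (leq_trans (dimvS (subvf _))) ?dimvf.
case: (\dim (limg g)) => [|[|//]] _; last by rewrite addn1 => -[].
rewrite addn0 => gT; case/negP: l0; apply/eqP/zeros_full => //.
by apply/eqP; rewrite eqEdim subvf dimvf /dim /= mul1n gT.
Qed.

Lemma zeros_inj (l m : {mpoly K[3]}) : l \is 1.-homog -> m \is 1.-homog ->
  m != 0 -> zeros l = zeros m -> exists c, l = c *: m.
Proof.
move=> hl hm m0 lm.
have [v mv] : exists v : 'rV[K]_3, m.@[v 0] != 0.
  apply: contrapT => mv; case/eqP: m0; apply: zeros_full => //.
  apply/vspaceP => v; rewrite memvf mem_zeros //; apply/negPn/negP => h.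
  by apply: mv; exists v.
exists (l.@[v 0] / m.@[v 0]); apply/eqP; rewrite -subr_eq0; apply/eqP.
set c := _ / _; have hc : l - c *: m \is 1.-homog by rewrite rpredB ?rpredZ.
apply: zeros_full => //; apply/vspaceP => w; rewrite memvf mem_zeros //.
rewrite mevalB mevalZ; pose t := m.@[w 0] / m.@[v 0].
have : w - t *: v \in zeros m.
  rewrite mem_zeros // addrC -scaleNr (zeros_linear hm) /GRing.scale /=.
  by rewrite mulNr divfK // addNr.
rewrite -lm mem_zeros // addrC -scaleNr (zeros_linear hl) /GRing.scale /=.
move/eqP => h; apply/eqP; rewrite -[RHS]h /t /c addrC mulNr.
by congr (_ - _); rewrite mulrAC [RHS]mulrAC [l.@[_] * _]mulrC.
Qed.

Lemma mem_intersection_points (A : arrangement) (P : point) :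
  (P \in intersection_points A) = (2 <= mult A P)%N.
Proof.
have dP (Q : point) : \dim Q = 1%N by apply/eqP; case: Q.
rewrite mem_undup mem_pmap_sub; apply/idP/idP.
  case/allpairsP => -[i j] /= [_ _ PE].
  have ij : i != j.
    apply/eqP => ij; move: (dP P); rewrite PE ij capvv.
    by rewrite dim_zeros ?form_homog ?form_neq0.
  have <- : #|[set i; j]| = 2%N by rewrite cards2 ij.
  apply: subset_leq_card; apply/subsetP => k; rewrite !inE /on_line.
  rewrite PE.
  by case/orP => /eqP ->; rewrite ?capvSl ?capvSr.
rewrite ltnNge => /negP h.
have [i [j [ij Pi Pj]]] : exists i j, [/\ i != j,
    on_line P (form A i) & on_line P (form A j)].
  apply: contrapT => nij; apply: h; apply/card_le1_eqP => i j.
  rewrite !inE => Pi Pj; apply/eqP/negPn/negP => ij.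
  by apply: nij; exists j, i.
apply/allpairsP; exists (i, j); split; rewrite ?mem_enum //=.
apply/eqP; rewrite eqEdim subv_cap; apply/andP; split; first exact/andP.
rewrite dP; set L := zeros _; set M := zeros _.
have dL : \dim L = 2%N by rewrite dim_zeros ?form_homog ?form_neq0.
have dM : \dim M = 2%N by rewrite dim_zeros ?form_homog ?form_neq0.
rewrite leqNgt; apply/negP => dLM.
have LM : (L :&: M)%VS = L by apply/eqP; rewrite eqEdim capvSl dL.
have ML : (L :&: M)%VS = M by apply/eqP; rewrite eqEdim capvSr dM.
have [//||||c] := @zeros_inj (form A i) (form A j);
  rewrite ?form_homog ?form_neq0 //; first exact: etrans (esym LM) ML.
exact: form_nonprop.
Qed.

Lemma homog_deriv (f : {mpoly K[3]}) (d : nat) (i : 'I_3) :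
  f \is d.-homog -> f^`M(i) \is d.-1.-homog.
Proof.
move=> hf; apply/dhomogP => m; rewrite mcoeff_msupp mcoeff_mderiv => fm.
have mf : (m + U_(i))%MM \in msupp f.
  by rewrite mcoeff_msupp; apply: contraNneq fm => ->; rewrite mul0rn.
have <- : mdeg (m + U_(i))%MM = d := dhomog_mf hf mf.
by rewrite mdegD mdeg1 addn1.
Qed.

Lemma homog_defining_poly (A : arrangement) :
  defining_poly A \is (nlines A).-homog.
Proof.
rewrite -[X in X.-homog]card_ord -sum1_card.
apply: (big_ind2 (fun (p : {mpoly K[3]}) d => p \is d.-homog)) => [|p d q e|i _].
- exact: dhomog1.
- exact: dhomogM.
- exact: form_homog.
Qed.

Lemma ex_syzygy (A : arrangement) :
  exists r, `[< has_syzygy (defining_poly A) r >].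
Proof.
set f := defining_poly A.
have hf i : f^`M(i) \is (nlines A).-1.-homog.
  exact/homog_deriv/homog_defining_poly.
have [f0|f0] := eqVneq f^`M(0) 0.
  exists 0%N; apply/asboolP; exists 1, 0, 0; split.
  - by split; rewrite ?dhomog1 ?rpred0.
  - by case=> /eqP; rewrite oner_eq0.
  - by rewrite f0 mulr0 !mul0r !addr0.
exists (nlines A).-1; apply/asboolP; exists f^`M(1), (- f^`M(0)), 0; split.
- by split; rewrite ?rpredN ?rpred0.
- by case=> _ /eqP; rewrite oppr_eq0 (negPf f0).
- by rewrite mulNr mul0r addr0 mulrC addrN.
Qed.

(* The invariant r(A). *)
Definition min_syzygy_degree (A : arrangement) : nat := ex_minn (ex_syzygy A).

End Arrangements.

(* Main.v *)
Require Import Defs.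
From mathcomp Require Import all_boot all_order all_algebra.
From mathcomp Require Import boolp mpoly ring zify.

Set Implicit Arguments.
Unset Strict Implicit.
Unset Printing Implicit Defensive.

Import GRing.Theory.
Local Open Scope ring_scope.

(** Let P be a point of maximal multiplicity m, let g be the product of the m
    forms vanishing at P and h the product of the d - m other ones. A syzygy of
    f = g h is a derivation t with t(f) = 0; such a t is logarithmic, that is,
    every form l of the arrangement divides t(l). Conversely, since d is
    invertible, a logarithmic derivation can be corrected by a multiple of the
    Euler derivation so as to kill f [syzygy_of_log].

    The constant derivation along P multiplied by h is logarithmic, which gives
    r <= d - m [syzygy_of_residual]. For a syzygy t of degree r < d - m, take
    two lines u, v through P and look at W = u t(v) - v t(u), which ignores
    Euler multiples. If W = 0 then t is, up to an Euler multiple, directed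
    along P, hence divisible by h, which its degree forbids. But every form
    through P divides W, so g divides W and m <= r + 1. With d <= 2 m this
    leaves only d = 2 m, r = m - 1 and W a constant multiple of g
    [low_degree_syzygy]. At an intersection point Q, t is tangent to two lines,
    so its value is proportional to Q and W(Q) = 0: some line through P passes
    through Q. In other words P is a modular point.

    Conversely, at a modular point there is a logarithmic derivation whose W is
    a nonzero constant multiple of g, built by adding the lines of h one at a time [add_line], and it yields a
    syzygy of degree m - 1 [syzygy_of_modular]. Thus r = m - 1 if d = 2 m and P
    is modular, and r = d - m otherwise.

    Modularity is visible in the weak combinatorics. Counting the pairs formed
    by a line through P and a line off P, the sum of mult Q - 1 over all
    intersection points Q is m - 1 + m (d - m) plus the contribution of the
    points lying on no line through P [sum_mult_pencil]; P is modular exactly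
    when that contribution vanishes. The number d itself is recovered from
    the sum of mult Q (mult Q - 1), which is d (d - 1) [sum_mult_pairs]. *)

(** * Divisibility by products of primes, and vectors of length three *)

Section Divisibility.
Variable R : idomainType.
Implicit Types (a b p q x : R).

Definition divides a b := exists q, b = q * a.

Definition prime_element a :=
  [/\ a != 0, ~ divides a 1 &
      forall p q, divides a (p * q) -> divides a p \/ divides a q].

Lemma divides_refl a : divides a a.
Proof. by exists 1; rewrite mul1r. Qed.

Lemma divides0 a : divides a 0.
Proof. by exists 0; rewrite mul0r. Qed.

Lemma dividesD a p q : divides a p -> divides a q -> divides a (p + q).
Proof. by case=> x -> [y ->]; exists (x + y); rewrite mulrDl. Qed.

Lemma dividesMl a p q : divides a q -> divides a (p * q).
Proof. by case=> x ->; exists (p * x); rewrite mulrA. Qed.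

Lemma dividesMr a p q : divides a p -> divides a (p * q).
Proof. by rewrite mulrC; apply: dividesMl. Qed.

Lemma dividesN a p : divides a p -> divides a (- p).
Proof. by move=> h; rewrite -mulN1r; apply: dividesMl. Qed.

Lemma dividesB a p q : divides a p -> divides a q -> divides a (p - q).
Proof. by move=> hp hq; apply/dividesD/dividesN. Qed.

Lemma dvd_prime_prod (I : eqType) (s : seq I) (F : I -> R) x :
    prime_element x -> (forall i, i \in s -> ~ divides x (F i)) ->
  ~ divides x (\prod_(i <- s) F i).
Proof.
move=> [_ x1 xP]; elim: s => [|i s IHs] xF; first by rewrite big_nil.
rewrite big_cons => /xP[]; first by apply: xF; rewrite mem_head.
by apply: IHs => j js; apply: xF; rewrite inE js orbT.
Qed.

(** Cancel the primes one at a time: each divides the remaining cofactor since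
    it does not divide [a]. *)
Lemma prod_primes_cancel (I : eqType) (s : seq I) (F : I -> R) a b :
    (forall i, i \in s -> prime_element (F i)) ->
    (forall i, i \in s -> ~ divides (F i) a) ->
  divides (\prod_(i <- s) F i) (a * b) -> divides (\prod_(i <- s) F i) b.
Proof.
elim: s b => [|i s IHs] b Fp Fa; first by exists b; rewrite big_nil mulr1.
rewrite big_cons => -[q abE].
have [F0 _ FP] := Fp i (mem_head _ _).
have [|/(Fa i (mem_head _ _))[]|[b' bE]] := FP a b.
  by exists (q * \prod_(j <- s) F j); rewrite abE mulrA mulrAC.
have [|||c cE] := IHs b'.
- by move=> j js; apply: Fp; rewrite inE js orbT.
- by move=> j js; apply: Fa; rewrite inE js orbT.
- exists q; apply: (mulfI F0); rewrite mulrCA [F i * b']mulrC -bE abE.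
  by rewrite mulrCA.
by exists c; rewrite bE cE mulrAC mulrA.
Qed.

(** Coprimality of the factors is expressed as a cancellation property, so that
    the factors may themselves be products of primes, as they are in
    [sigma_prod_divides]. *)
Lemma prod_coprime_divides (I : eqType) (s : seq I) (G : I -> R) p :
    uniq s -> (forall i, i \in s -> divides (G i) p) ->
    (forall i j b, i \in s -> j \in s -> i != j ->
       divides (G i) (G j * b) -> divides (G i) b) ->
  divides (\prod_(i <- s) G i) p.
Proof.
elim: s p => [|i s IHs] p /=; first by exists p; rewrite big_nil mulr1.
case/andP=> i_s us Gp Gc; have [q pE] := Gp i (mem_head _ _).
have [//||c qE] := IHs q us.
- move=> j js; have ji: j != i by apply: contraNneq i_s => <-.
  apply: (Gc j i); rewrite ?mem_head ?inE ?js ?orbT //.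
  by rewrite mulrC -pE; apply: Gp; rewrite inE js orbT.
- by move=> j k b js ks; apply: Gc; rewrite inE ?js ?ks orbT.
by exists c; rewrite big_cons pE qE mulrAC mulrA.
Qed.

Lemma prod_primes_divides (I : eqType) (s : seq I) (F : I -> R) p :
    uniq s -> (forall i, i \in s -> prime_element (F i)) ->
    (forall i j, i \in s -> j \in s -> i != j -> ~ divides (F i) (F j)) ->
    (forall i, i \in s -> divides (F i) p) ->
  divides (\prod_(i <- s) F i) p.
Proof.
move=> us Fp Fc Fd; apply: prod_coprime_divides => // i j b iS jS ij.
by have [_ _ FP] := Fp i iS; case/FP=> // /(Fc i j iS jS ij).
Qed.

End Divisibility.

Section ThreeVectors.

Lemma sum3 (V : nmodType) (F : 'I_3 -> V) : \sum_i F i = F 0 + F 1 + F 2.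
Proof.
rewrite !big_ord_recr big_ord0 /= add0r.
by congr (F _ + F _ + F _); apply/val_inj.
Qed.

Lemma forall_ord3 (P : 'I_3 -> Prop) : P 0 -> P 1 -> P 2 -> forall i, P i.
Proof.
move=> P0 P1 P2 [[|[|[|//]]] lti]; [move: P0|move: P1|move: P2];
  by congr P; apply/val_inj.
Qed.

(** The vector product; the additions of indices are in Z/3. *)
Definition crossp (R : pzRingType) (u v : 'I_3 -> R) (i : 'I_3) : R :=
  u (i + 1) * v (i + 2) - u (i + 2) * v (i + 1).

Let ord3E : (0 + 1 = 1 :> 'I_3) * (0 + 2 = 2 :> 'I_3) * (1 + 1 = 2 :> 'I_3)
  * (1 + 2 = 0 :> 'I_3) * (2 + 1 = 0 :> 'I_3) * (2 + 2 = 1 :> 'I_3).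
Proof. by do !split; apply/val_inj. Qed.

Lemma crossp_neq0 (R : comPzRingType) (u v : 'I_3 -> R) i j :
  u i * v j != u j * v i -> exists k, crossp u v k != 0.
Proof.
move=> uv; apply: contrapT => n0; have {}n0 c : crossp u v c = 0.
  by apply/eqP/negPn/negP => nc; apply: n0; exists c.
have := n0 0; have := n0 1; have := n0 2; rewrite /crossp !ord3E.
move=> /subr0_eq m2 /subr0_eq m1 /subr0_eq m0.
case/eqP: uv; move: i j; apply: forall_ord3; apply: forall_ord3 => //;
by rewrite ?m0 ?m1 ?m2.
Qed.

(** The double product formula (u x v) x c = (u . c) v - (v . c) u. *)
Lemma crossp_parallel (R : comPzRingType) (u v c : 'I_3 -> R) :
    \sum_i u i * c i = 0 -> \sum_i v i * c i = 0 ->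
  forall i j, crossp u v i * c j = crossp u v j * c i.
Proof.
rewrite !sum3 => uc vc.
have cr x y : x * (u 0 * c 0 + u 1 * c 1 + u 2 * c 2)
    - y * (v 0 * c 0 + v 1 * c 1 + v 2 * c 2) = 0 by rewrite uc vc !mulr0 subrr.
have n01 : crossp u v 0 * c 1 = crossp u v 1 * c 0.
  by apply/subr0_eq; rewrite -(cr (v 2) (u 2)) /crossp !ord3E; ring.
have n12 : crossp u v 1 * c 2 = crossp u v 2 * c 1.
  by apply/subr0_eq; rewrite -(cr (v 0) (u 0)) /crossp !ord3E; ring.
have n20 : crossp u v 2 * c 0 = crossp u v 0 * c 2.
  by apply/subr0_eq; rewrite -(cr (v 1) (u 1)) /crossp !ord3E; ring.
by apply: forall_ord3; apply: forall_ord3.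
Qed.

Lemma common_zeros_parallel (R : idomainType) (u v a b : 'I_3 -> R) k l :
    u k * v l != u l * v k ->
    \sum_i u i * a i = 0 -> \sum_i v i * a i = 0 ->
    \sum_i u i * b i = 0 -> \sum_i v i * b i = 0 ->
  forall i j, a i * b j = a j * b i.
Proof.
move=> /crossp_neq0[c nc] ua va ub vb i j; apply/(mulfI nc)/(mulfI nc).
have ha := crossp_parallel ua va; have hb := crossp_parallel ub vb.
have E x y : crossp u v c * (crossp u v c * (x * y)) =
    (crossp u v c * x) * (crossp u v c * y) by ring.
by rewrite !E !(ha c) !(hb c); ring.
Qed.

(** The three covectors vanish on a common nonzero vector, hence have
    determinant zero, and Cramer's rule expresses [w] through the other two. *)
Lemma common_zero_comb (F : fieldType) (w u v q : 'I_3 -> F) i j k :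
    u i * v j != u j * v i -> q k != 0 ->
    \sum_i w i * q i = 0 -> \sum_i u i * q i = 0 -> \sum_i v i * q i = 0 ->
  exists a b, forall x, w x = a * u x + b * v x.
Proof.
move=> /crossp_neq0[c nc] qk wq uq vq.
have det0 : \sum_i w i * crossp u v i = 0.
  apply: (mulIf qk); rewrite mul0r mulr_suml.
  under eq_bigr => x _ do rewrite -mulrA (crossp_parallel uq vq) mulrCA.
  by rewrite -mulr_sumr wq mulr0.
have cramer x : crossp u v c * w x =
    - crossp v w c * u x - crossp w u c * v x + (x == c)%:R *
      \sum_i w i * crossp u v i.
  rewrite sum3; move: c x {nc}; apply: forall_ord3; apply: forall_ord3;
  by rewrite /crossp !ord3E /=; ring.
exists (- crossp v w c / crossp u v c), (- crossp w u c / crossp u v c) => x.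
apply: (mulfI nc); rewrite cramer det0 mulr0 addr0 mulrDr.
by congr (_ + _); rewrite -?mulNr; field.
Qed.

End ThreeVectors.

(** * Linear forms as primes of the polynomial ring *)

Section LinearForms.
Variable K : fieldType.
Local Notation S := {mpoly K[3]}.
Implicit Types (l m p q : S) (v : 'I_3 -> K).

Definition lcoef l (i : 'I_3) : K := l@_U_(i).

Lemma lin_expand l : l \is 1.-homog -> l = \sum_i lcoef l i *: 'X_i.
Proof.
move=> hl; have hr : \sum_i lcoef l i *: ('X_i : S) \is 1.-homog.
  by apply: rpred_sum => i _; rewrite rpredZ // dhomogX /= mdeg1.
apply/mpolyP => k; have [k1|k1] := eqVneq (mdeg k) 1%N; last first.
  by rewrite (dhomog_nemf_coeff hl k1) (dhomog_nemf_coeff hr k1).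
move/eqP: k1; rewrite mdeg_eq1 => /existsP[i /eqP ->].
rewrite raddf_sum /= (bigD1 i) //= mcoeffZ mcoeffXU eqxx mulr1.
rewrite big1 ?addr0 // => j ji.
by rewrite mcoeffZ mcoeffXU (negPf ji) mulr0.
Qed.

Lemma lin_eval l v : l \is 1.-homog -> l.@[v] = \sum_i lcoef l i * v i.
Proof.
move=> hl; rewrite {1}(lin_expand hl) raddf_sum /=.
by apply: eq_bigr => i _; rewrite mevalZ mevalXU.
Qed.

Lemma lin_deriv l i : l \is 1.-homog -> l^`M(i) = (lcoef l i)%:MP.
Proof.
move=> hl; rewrite {1}(lin_expand hl) raddf_sum /= (bigD1 i) //= mderivZ mderivX.
rewrite mnm1E eqxx scale1r big1 ?addr0 => [|j ji]; last first.
  by rewrite mderivZ mderivX mnm1E (negPf ji) scale0r scaler0.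
suff -> : (U_(i) - U_(i) = 0 :> 'X_{1..3})%MM by rewrite mpolyX0 alg_mpolyC.
by apply/mnmP => j; rewrite mnmBE subnn mnm0E.
Qed.

Lemma lin_neq0 l : l \is 1.-homog -> l != 0 -> exists i, lcoef l i != 0.
Proof.
move=> hl l0; apply: contrapT => nl; case/eqP: l0; rewrite (lin_expand hl).
apply: big1 => i _; suff /eqP -> : lcoef l i == 0 by rewrite scale0r.
by apply/negPn/negP => li; apply: nl; exists i.
Qed.

(** Eliminates the variable [i] by means of the equation l = 0: a ring
    endomorphism with kernel the ideal (l) when [lcoef l i] is nonzero. It
    stands for the restriction of polynomials to the line l = 0. *)
Definition subst_line l (i : 'I_3) p : S :=
  p \mPo [tuple 'X_j - (i == j)%:R *: ((lcoef l i)^-1 *: l) | j < 3].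

Lemma subst_lineM l i : {morph subst_line l i : p q / p * q}.
Proof. by move=> p q; rewrite /subst_line rmorphM. Qed.

Lemma subst_lineB l i : {morph subst_line l i : p q / p - q}.
Proof. by move=> p q; rewrite /subst_line rmorphB. Qed.

Lemma subst_line1 l i : subst_line l i 1 = 1.
Proof. by rewrite /subst_line rmorph1. Qed.

Lemma subst_line_prod l i (I : Type) (s : seq I) (P : pred I) F :
  subst_line l i (\prod_(j <- s | P j) F j) =
  \prod_(j <- s | P j) subst_line l i (F j).
Proof. exact: (big_morph _ (subst_lineM l i) (subst_line1 l i)). Qed.

Lemma subst_line_lin l i m : m \is 1.-homog ->
  subst_line l i m = m - (lcoef m i / lcoef l i) *: l.
Proof.
move=> hm; rewrite {1 2}(lin_expand hm) /subst_line raddf_sum /=.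
under eq_bigr => j _ do
  rewrite comp_mpolyZ comp_mpolyXU -tnth_nth tnth_mktuple scalerBr.
rewrite big_split /=; congr (_ + _); rewrite (bigD1 i) //= eqxx scale1r.
rewrite big1 ?addr0 => [|j ji]; first by rewrite scalerA.
by rewrite eq_sym (negPf ji) scale0r scaler0 oppr0.
Qed.

Lemma subst_line_id l i : l \is 1.-homog -> lcoef l i != 0 ->
  subst_line l i l = 0.
Proof. by move=> hl li; rewrite subst_line_lin // divff // scale1r subrr. Qed.

(** Congruence modulo [l] is compatible with sums and products, so it suffices
    to check the variables. *)
Lemma subst_line_mod l i p : divides l (p - subst_line l i p).
Proof.
have cong_mul a b c d : divides l (a - b) -> divides l (c - d) ->
    divides l (a * c - b * d).
  move=> ab cd; have -> : a * c - b * d = (a - b) * c + b * (c - d) by ring.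
  by apply: dividesD; [apply: dividesMr | apply: dividesMl].
have congX (k : 'X_{1..3}) : divides l ('X_[k] - subst_line l i 'X_[k]).
  rewrite mpolyXE_id /subst_line rmorph_prod /=.
  apply: (big_ind2 (fun a b => divides l (a - b))) => [|a b c d|j _].
  - by rewrite subrr; apply: divides0.
  - exact: cong_mul.
  (* A variable and its image differ by a scalar multiple of [l]. *)
  rewrite rmorphXn /= comp_mpolyXU -tnth_nth tnth_mktuple.
  elim: (k j) => [|n IHn]; first by rewrite subrr; apply: divides0.
  rewrite !exprS; apply: cong_mul => //; rewrite opprB addrC subrK.
  by rewrite scalerA -mul_mpolyC; apply: dividesMl; exists 1; rewrite mul1r.
rewrite {1}[p]mpolyE {1}/subst_line comp_mpolyEX -sumrB.
elim/big_ind: _ => [||k _]; [exact: divides0 | exact: dividesD |].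
by rewrite -scalerBr -mul_mpolyC; apply: dividesMl.
Qed.

Lemma divides_subst_line l i p : l \is 1.-homog -> lcoef l i != 0 ->
  divides l p <-> subst_line l i p = 0.
Proof.
move=> hl li; split=> [[q ->]|p0].
  by rewrite subst_lineM subst_line_id // mulr0.
by have := subst_line_mod l i p; rewrite p0 subr0.
Qed.

(** The ideal (l) is the kernel of a ring endomorphism of an integral domain. *)
Lemma lin_prime l : l \is 1.-homog -> l != 0 -> prime_element l.
Proof.
move=> hl l0; have [i li] := lin_neq0 hl l0.
have dvdE p := divides_subst_line p hl li; split=> // [/dvdE|p q /dvdE].
  by rewrite subst_line1 => /eqP; rewrite oner_eq0.
by rewrite subst_lineM => /eqP; rewrite mulf_eq0 => /orP[]/eqP/dvdE; auto.
Qed.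

Lemma lin_divides_lin l m : l \is 1.-homog -> m \is 1.-homog -> m != 0 ->
  divides m l -> exists c, l = c *: m.
Proof.
move=> hl hm m0; have [i mi] := lin_neq0 hm m0.
move/(divides_subst_line _ hm mi); rewrite subst_line_lin // => /subr0_eq lm.
by exists (lcoef l i / lcoef m i).
Qed.

(** Non-proportionality is used throughout in the form of a nonzero 2 x 2 minor,
    the hypothesis under which two lines have a single common point. *)
Lemma lin_minor l m : l \is 1.-homog -> m \is 1.-homog -> m != 0 ->
    (forall c, l <> c *: m) ->
  exists i j, lcoef l i * lcoef m j != lcoef l j * lcoef m i.
Proof.
move=> hl hm m0 lm; apply: contrapT => nij; have [j mj] := lin_neq0 hm m0.
apply: (lm (lcoef l j / lcoef m j)); rewrite {1}(lin_expand hl) {2}(lin_expand hm).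
rewrite scaler_sumr; apply: eq_bigr => i _; rewrite scalerA; congr (_ *: _).
apply/(mulIf mj); have /eqP -> : lcoef l i * lcoef m j == lcoef l j * lcoef m i.
  by apply/negPn/negP => ij; apply: nij; exists i, j.
by rewrite mulrAC divfK.
Qed.

Lemma lin_comb a b l m : l \is 1.-homog -> m \is 1.-homog ->
  a *: l + b *: m \is 1.-homog.
Proof. by move=> hl hm; rewrite rpredD ?rpredZ. Qed.

End LinearForms.

(** * Derivations, logarithmic derivations and syzygies *)

Section Derivations.
Variable K : fieldType.
Local Notation S := {mpoly K[3]}.
Implicit Types (l m p q u v : S) (t : 'I_3 -> S).

(** A triple of polynomials acts as the vector field with these components; the
    syzygies of [f] are the fields that kill [f]. The family of the variables is
    the Euler field, and a constant family is the derivative along a vector. *)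
Definition der t p : S := \sum_i t i * p^`M(i).

Lemma derM t p q : der t (p * q) = der t p * q + p * der t q.
Proof.
rewrite /der mulr_suml mulr_sumr -big_split /=; apply: eq_bigr => i _.
by rewrite mderivM; ring.
Qed.

Lemma der_linear t a p b q :
  der t (a *: p + b *: q) = a *: der t p + b *: der t q.
Proof.
rewrite /der !scaler_sumr -big_split /=; apply: eq_bigr => i _.
by rewrite mderivD !mderivZ mulrDr !scalerAr.
Qed.

Lemma der_comb t a t' p : der (fun i => t i + a * t' i) p = der t p + a * der t' p.
Proof.
rewrite /der mulr_sumr -big_split /=; apply: eq_bigr => i _.
by rewrite mulrDl mulrA.
Qed.

Lemma der_mul a t p : der (fun i => a * t i) p = a * der t p.
Proof. by rewrite /der mulr_sumr; apply: eq_bigr => i _; rewrite mulrA. Qed.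

Lemma der_euler l : l \is 1.-homog -> der (fun i => 'X_i) l = l.
Proof.
move=> hl; rewrite {2}(lin_expand hl); apply: eq_bigr => i _.
by rewrite lin_deriv // mulrC mul_mpolyC.
Qed.

Lemma der_const (w : 'I_3 -> K) l : l \is 1.-homog ->
  der (fun i => (w i)%:MP) l = (l.@[w])%:MP.
Proof.
move=> hl; rewrite lin_eval // (raddf_sum (@mpolyC 3 K)); apply: eq_bigr => i _ /=.
by rewrite lin_deriv // mpolyCM mulrC.
Qed.

Lemma der_lin t l : l \is 1.-homog -> der t l = \sum_i (lcoef l i)%:MP * t i.
Proof. by move=> hl; apply: eq_bigr => i _; rewrite lin_deriv // mulrC. Qed.

Lemma eval_der t l w : l \is 1.-homog ->
  (der t l).@[w] = l.@[fun i => (t i).@[w]].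
Proof.
move=> hl; rewrite der_lin // [RHS]lin_eval // raddf_sum; apply: eq_bigr => i _ /=.
by rewrite mevalM mevalC.
Qed.

Lemma der_prod_log (I : eqType) (s : seq I) (F : I -> S) t :
    (forall i, i \in s -> divides (F i) (der t (F i))) ->
  divides (\prod_(i <- s) F i) (der t (\prod_(i <- s) F i)).
Proof.
elim: s => [|i s IHs] tF.
  by rewrite big_nil; exists (der t 1); rewrite mulr1.
have [q qE] := tF i (mem_head _ _); have [|p pE] := IHs.
  by move=> j js; apply: tF; rewrite inE js orbT.
exists (q + p); rewrite big_cons derM qE pE; ring.
Qed.

Lemma der_euler_prod (I : Type) (s : seq I) (F : I -> S) :
    (forall i, F i \is 1.-homog) ->
  der (fun i => 'X_i) (\prod_(i <- s) F i) = (size s)%:R * \prod_(i <- s) F i.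
Proof.
move=> hF; elim: s => [|i s IHs].
  by rewrite big_nil mul0r /der big1 // => i _; rewrite -mpolyC1 mderivC mulr0.
by rewrite big_cons derM der_euler // IHs /= -[(size s).+1]add1n natrD; ring.
Qed.

(** The 2-form obtained by contracting du /\ dv with the Euler field and [t], so
    it only depends on [t] modulo Euler multiples ([cross_euler]). *)
Definition cross t u v : S := u * der t v - v * der t u.

Lemma cross_euler t a u v : u \is 1.-homog -> v \is 1.-homog ->
  cross (fun i => t i + a * 'X_i) u v = cross t u v.
Proof. by move=> hu hv; rewrite /cross !der_comb !der_euler //; ring. Qed.

(** Because of this and its consequences for [der] and [cross], logarithmic fields
    can be built with arbitrary components, and the component of the right
    degree extracted at the end, in [syzygy_of_log]. *)
Lemma pihomogM d e p q : q \is e.-homog ->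
  pihomog mdeg (d + e) (p * q) = pihomog mdeg d p * q.
Proof.
move=> hq; rewrite {1}(pihomog_partitionE (leqnn (msize p))) mulr_suml raddf_sum /=.
have homM c : pihomog mdeg c p * q \is (c + e).-homog.
  by apply: dhomogM => //; apply: pihomogP.
have [dp|pd] := ltnP d (msize p).
  rewrite (bigD1 (Ordinal dp)) //= pihomog_dE // big1 ?addr0 // => c cd.
  apply: pihomog_ne0 (homM c).
  by rewrite eqn_add2r; apply: contraNneq cd => cd; apply/eqP/val_inj.
rewrite big1 => [|c _].
  have -> : pihomog mdeg d p = 0; last by rewrite mul0r.
  rewrite pihomogE big_seq_cond big_pred0 // => k; apply/negP => /andP[kp /eqP kd].
  by have := msize_mdeg_lt kp; rewrite kd ltnNge pd.
apply: pihomog_ne0 (homM c).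
by rewrite eqn_add2r; apply: contraTneq (ltn_ord c) => ->; rewrite -leqNgt.
Qed.

Lemma pihomog_der t d e p : (forall i, p^`M(i) \is e.-homog) ->
  pihomog mdeg (d + e) (der t p) = der (fun i => pihomog mdeg d (t i)) p.
Proof.
by move=> hp; rewrite raddf_sum /=; apply: eq_bigr => i _; rewrite pihomogM.
Qed.

Lemma pihomog_cross t d u v : u \is 1.-homog -> v \is 1.-homog ->
  pihomog mdeg d.+1 (cross t u v) = cross (fun i => pihomog mdeg d (t i)) u v.
Proof.
move=> hu hv; have hd w : w \is 1.-homog ->
    pihomog mdeg d (der t w) = der (fun i => pihomog mdeg d (t i)) w.
  move=> hw; rewrite -[d in LHS]addn0 pihomog_der // => i.
  by rewrite lin_deriv // -[_%:MP]mulr1 mul_mpolyC rpredZ // dhomog1.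
by rewrite /cross raddfB /= -[d.+1]addn1 !(mulrC _ (der _ _)) !pihomogM // !hd.
Qed.

End Derivations.

Section Logarithmic.
Variables (K : fieldType) (A : arrangement K).
Local Notation S := {mpoly K[3]}.
Local Notation f := (defining_poly A).
Local Notation l := (@Defs.form K A).
Implicit Types (p q u v : S) (t : 'I_3 -> S).

Lemma form_prime i : prime_element (l i).
Proof. by apply: lin_prime; [apply: form_homog | apply: form_neq0]. Qed.

Lemma form_ndivides i j : i != j -> ~ divides (l i) (l j).
Proof.
rewrite eq_sym => ij /lin_divides_lin[]; rewrite ?form_homog ?form_neq0 //.
by move=> c; apply: form_nonprop.
Qed.

Lemma euler_defining_poly :
  der (fun i => 'X_i) f = (nlines A)%:R * f.
Proof.
rewrite der_euler_prod; last exact: form_homog.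
by rewrite -sum1_size sum1_card card_ord.
Qed.

Lemma prod_forms_divides (P : pred 'I_(nlines A)) p :
  (forall i, P i -> divides (l i) p) -> divides (\prod_(i | P i) l i) p.
Proof.
move=> Pp; rewrite -big_filter; apply: prod_primes_divides => [|i _|i j _ _|i].
- exact/filter_uniq/index_enum_uniq.
- exact: form_prime.
- exact: form_ndivides.
- by rewrite mem_filter => /andP[/Pp].
Qed.

(** By Leibniz, [l i] divides the product of [der t (l i)] with the other forms,
    none of which it divides. *)
Lemma log_of_syzygy t i : der t f = 0 -> divides (l i) (der t (l i)).
Proof.
rewrite /defining_poly (bigD1 i) //= derM => /eqP; rewrite addr_eq0 => /eqP tf.
have [_ _ lP] := form_prime i.
have : divides (l i) (der t (l i) * \prod_(j < nlines A | j != i) l j).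
  by rewrite tf; apply/dividesN/dividesMr/divides_refl.
case/lP => //; rewrite -big_filter => h; exfalso; move: h.
apply: dvd_prime_prod (form_prime i) _ => j; rewrite mem_filter eq_sym.
by case/andP=> ij _; apply: form_ndivides.
Qed.

(** By Leibniz der t f = q f for some q, and the Euler field E satisfies
    der E f = d f, so t - (q / d) E kills [f], and so does each homogeneous
    component of it. This changes nothing in [cross t u v], whose nonvanishing
    guarantees that the component of degree [k] is not zero. *)
Lemma syzygy_of_log t u v k : [pchar K] =i pred0 -> (0 < nlines A)%N ->
    (forall i, divides (l i) (der t (l i))) ->
    u \is 1.-homog -> v \is 1.-homog ->
    cross t u v \is k.+1.-homog -> cross t u v != 0 ->
  has_syzygy f k.
Proof.
move=> char0 d0 tl hu hv hW W0; set d := nlines A in d0.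
have dK : d%:R != 0 :> K by rewrite ((pcharf0P K).1 char0) -lt0n.
have [q qE] : divides f (der t f) by apply: der_prod_log.
pose t' i := t i + (- (d%:R^-1 *: q)) * 'X_i.
have t'f : der t' f = 0.
  rewrite der_comb euler_defining_poly qE -/d -mpolyC_nat mul_mpolyC mulNr.
  by rewrite -scalerAl -scalerAr scalerA mulVf // scale1r subrr.
pose t'' i := pihomog mdeg k (t' i).
have t''f : der t'' f = 0.
  have hf i : f^`M(i) \is (nlines A).-1.-homog.
    exact/homog_deriv/homog_defining_poly.
  by rewrite -(pihomog_der _ _ hf) t'f pihomog0.
have t''0 : cross t'' u v != 0.
  by rewrite -pihomog_cross // cross_euler // pihomog_dE.
exists (t'' 0), (t'' 1), (t'' 2); split.
- by split; apply: pihomogP.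
- case=> a b c; case/eqP: t''0; have t0 i : t'' i = 0 by move: i; apply: forall_ord3.
  have d0' p : der t'' p = 0 by apply: big1 => i _; rewrite t0 mul0r.
  by rewrite /cross !d0' !mulr0 subrr.
- by rewrite -t''f /der sum3.
Qed.

End Logarithmic.

(** * Points and lines *)

Section Points.
Variable K : fieldType.
Implicit Types (P Q : point K) (l m : {mpoly K[3]}).

(** Homogeneous coordinates of a point. *)
Definition coords P : 'I_3 -> K := vpick P 0.

Lemma point_span P : point_space P = <[vpick P]>%VS.
Proof.
have P1 : \dim P = 1%N by apply/eqP; case: P.
apply/esym/eqP; rewrite eqEdim -memvE memv_pick P1 dim_vline.
by rewrite vpick0 -dimv_eq0 P1.
Qed.

Lemma coords_neq0 P : exists i, coords P i != 0.
Proof.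
apply: contrapT => c0.
have : vpick P == 0.
  apply/eqP/rowP => i; rewrite mxE; apply/eqP/negPn/negP => ci.
  by apply: c0; exists i.
have P1 : \dim P = 1%N by apply/eqP; case: (P).
by rewrite vpick0 -dimv_eq0 P1.
Qed.

Lemma on_lineE P l : l \is 1.-homog -> on_line P l = (l.@[coords P] == 0).
Proof. by move=> hl; rewrite /on_line point_span -memvE mem_zeros. Qed.

Lemma on_line_coords P l : l \is 1.-homog -> on_line P l ->
  \sum_i lcoef l i * coords P i = 0.
Proof. by move=> hl; rewrite on_lineE // lin_eval // => /eqP. Qed.

Lemma eq_point P Q :
  (forall i j, coords P i * coords Q j = coords P j * coords Q i) -> P = Q.
Proof.
move=> PQ; have [j Qj] := coords_neq0 Q.
have dim1 (T : point K) : \dim T = 1%N by apply/eqP; case: T.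
apply/val_inj/eqP; rewrite /= eqEdim !dim1 andbT (point_span P) -memvE.
suff -> : vpick P = (coords P j / coords Q j) *: vpick Q.
  by rewrite memvZ ?memv_pick.
apply/rowP => i; rewrite !mxE -/(coords P i) -/(coords Q i) mulrAC -PQ.
by rewrite mulfK.
Qed.

Lemma two_lines_point l m i j P Q : l \is 1.-homog -> m \is 1.-homog ->
    lcoef l i * lcoef m j != lcoef l j * lcoef m i ->
  on_line P l -> on_line P m -> on_line Q l -> on_line Q m -> P = Q.
Proof.
move=> hl hm lm Pl Pm Ql Qm; apply: eq_point.
by apply: common_zeros_parallel lm _ _ _ _; apply: on_line_coords.
Qed.

Lemma concurrent_comb l m n i j P :
    l \is 1.-homog -> m \is 1.-homog -> n \is 1.-homog ->
    lcoef m i * lcoef n j != lcoef m j * lcoef n i ->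
    on_line P l -> on_line P m -> on_line P n ->
  exists a b, l = a *: m + b *: n.
Proof.
move=> hl hm hn mn Pl Pm Pn; have [k Pk] := coords_neq0 P.
have [||| a [b lE]] := common_zero_comb (w := lcoef l) mn Pk;
  try exact: on_line_coords.
exists a, b; rewrite (lin_expand hl) (lin_expand hm) (lin_expand hn).
rewrite !scaler_sumr -big_split /=; apply: eq_bigr => x _.
by rewrite lE scalerDl !scalerA.
Qed.

(** Two planes of a space of dimension 3 have a nonzero intersection. *)
Lemma lines_meet l m : l \is 1.-homog -> m \is 1.-homog ->
  l != 0 -> m != 0 -> exists P, on_line P l && on_line P m.
Proof.
move=> hl hm l0 m0; have := dimv_sum_cap (zeros l) (zeros m).
rewrite !dim_zeros //; set U := (_ :&: _)%VS => dimU.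
have U0 : vpick U != 0.
  rewrite vpick0 -dimv_eq0; have := dimvS (subvf (zeros l + zeros m)).
  by rewrite dimvf /dim /= mul1n; lia.
have dim1 : \dim <[vpick U]> == 1%N by rewrite dim_vline U0.
exists (Point dim1); have := memv_pick U.
by rewrite memv_cap /on_line -!memvE.
Qed.

End Points.

(** * Syzygies of low degree and the point of high multiplicity *)

Section Homogeneity.
Variable K : fieldType.
Local Notation S := {mpoly K[3]}.
Implicit Types (p q : S).

Lemma msize_homog p d : p \is d.-homog -> (msize p <= d.+1)%N.
Proof.
move=> hp; rewrite msizeE; apply/bigmax_leqP_seq => m mp _.
by have := dhomog_mf hp mp => /= ->.
Qed.

Lemma msize_homog_neq0 p d : p \is d.-homog -> p != 0 -> msize p = d.+1.
Proof.
move=> hp p0; rewrite -(mlead_deg p0); congr _.+1.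
exact: (dhomog_mf hp (mlead_supp p0)).
Qed.

Lemma prod_homog (I : finType) (P : pred I) (F : I -> S) :
  (forall i, F i \is 1.-homog) -> \prod_(i | P i) F i \is #|P|.-homog.
Proof.
move=> hF; rewrite -sum1_card.
apply: (big_ind2 (fun (p : S) d => p \is d.-homog)) => [|p d q e|i _] //.
- exact: dhomog1.
- exact: dhomogM.
Qed.

Lemma msize_gt0 p : p != 0 -> (0 < msize p)%N.
Proof. by rewrite lt0n msize_poly_eq0. Qed.

Lemma msize_mul p q : p != 0 -> q != 0 ->
  (msize (p * q)).+1 = (msize p + msize q)%N.
Proof.
by move=> p0 q0; rewrite msizeM // prednK // addn_gt0 msize_gt0.
Qed.

(** Degrees add up in an integral domain, so the cofactor of two polynomials of
    the same degree is constant. *)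
Lemma divides_homog p q d : divides p q -> q \is d.-homog -> q != 0 ->
  (msize p <= d.+1)%N /\ (msize p = d.+1 -> exists2 c, c != 0 & q = c *: p).
Proof.
move=> [s ->] hsp /[dup] sp0; rewrite mulf_eq0 => /norP[s0 p0].
have := msize_mul s0 p0; rewrite (msize_homog_neq0 hsp sp0) => sz.
have s1 := msize_gt0 s0.
split=> [|pd]; first by lia.
have /msize_poly1P[c c0 ->] : msize (s : S) == 1%N by apply/eqP; lia.
by exists c => //; rewrite mul_mpolyC.
Qed.

End Homogeneity.

Section Multiple.
Variables (K : fieldType) (char0 : [pchar K] =i pred0).
Variables (A : arrangement K) (P : point K).
Local Notation S := {mpoly K[3]}.
Local Notation f := (defining_poly A).
Local Notation l := (@Defs.form K A).
Implicit Types (p q u v : S) (t : 'I_3 -> S).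

Definition through (i : 'I_(nlines A)) : bool := on_line P (l i).
Definition pencil_poly : S := \prod_(i | through i) l i.
Definition residual_poly : S := \prod_(i | ~~ through i) l i.

Let hl i : l i \is 1.-homog := form_homog i.
Let l0 i : l i != 0 := form_neq0 i.

Lemma card_through : #|[pred i | through i]| = mult A P.
Proof. by apply: eq_card => i; rewrite !inE. Qed.

Lemma card_residual : #|[pred i | ~~ through i]| = (nlines A - mult A P)%N.
Proof.
have := cardC [pred i | through i]; rewrite card_ord card_through => dE.
by rewrite -[in RHS]dE addKn; apply: eq_card => i; rewrite !inE.
Qed.

Lemma pencil_homog : pencil_poly \is (mult A P).-homog.
Proof. by rewrite -card_through; apply: prod_homog. Qed.

Lemma residual_homog : residual_poly \is (nlines A - mult A P).-homog.
Proof. by rewrite -card_residual; apply: prod_homog. Qed.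

Lemma pencil_neq0 : pencil_poly != 0.
Proof. by apply/prodf_neq0 => i _. Qed.

Lemma residual_neq0 : residual_poly != 0.
Proof. by apply/prodf_neq0 => i _. Qed.

Lemma through_eval i : through i = ((l i).@[coords P] == 0).
Proof. exact: on_lineE. Qed.

Lemma form_minor i j : i != j ->
  exists a b, lcoef (l i) a * lcoef (l j) b != lcoef (l i) b * lcoef (l j) a.
Proof. by move=> ij; apply: lin_minor => // c; apply: form_nonprop. Qed.

Lemma pencil_comb i j k : i != j -> through i -> through j -> through k ->
  exists a b, l k = a *: l i + b *: l j.
Proof.
by move=> /form_minor[a [b ab]] Pi Pj Pk; apply: concurrent_comb ab Pk Pi Pj.
Qed.

(** The field [residual_poly] times the derivative along [P] is logarithmic: it
    kills the forms through [P] and multiplies the others by a multiple of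
    [residual_poly]. *)
Lemma syzygy_of_residual i j : through i -> ~~ through j ->
  has_syzygy f (nlines A - mult A P).
Proof.
move=> Pi Pj; pose t k := residual_poly * (coords P k)%:MP.
have tE k : der t (l k) = (l k).@[coords P] *: residual_poly.
  by rewrite der_mul der_const // mulrC mul_mpolyC.
have crossE : cross t (l i) (l j) =
    (l j).@[coords P] *: (residual_poly * l i).
  move: Pi; rewrite /cross !tE through_eval => /eqP ->.
  by rewrite scale0r mulr0 subr0 -scalerAr mulrC.
apply: (syzygy_of_log (t := t) (u := l i) (v := l j)) => //.
- exact: leq_ltn_trans (ltn_ord i).
- move=> k; rewrite tE; have [|nPk] := boolP (through k).
    by rewrite through_eval => /eqP ->; rewrite scale0r; apply: divides0.
  rewrite -mul_mpolyC; apply: dividesMl; rewrite /residual_poly (bigD1 k) //=.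
  exact/dividesMr/divides_refl.
- rewrite crossE rpredZ // -[(nlines A - _).+1]addn1.
  by apply: dhomogM => //; apply: residual_homog.
- rewrite crossE scaler_eq0 mulf_eq0 negb_or -through_eval Pj negb_or.
  by rewrite residual_neq0 l0.
Qed.

Section LowDegree.
Variables (t : 'I_3 -> S) (r : nat) (a b : 'I_(nlines A)).
Hypotheses (th : forall k, t k \is r.-homog) (tn0 : exists k, t k != 0).
Hypothesis (tf : der t f = 0).
Hypotheses (ab : a != b) (Pa : through a) (Pb : through b).

Lemma der_homog k : der t (l k) \is r.-homog.
Proof.
rewrite der_lin //; apply: (big_ind (fun p : S => p \is r.-homog)) => [|p q|i _].
- exact: dhomog0.
- exact: dhomogD.
by rewrite mul_mpolyC; apply: dhomogZ.
Qed.

Lemma cross_homog : cross t (l a) (l b) \is r.+1.-homog.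
Proof.
by rewrite -[r.+1]add1n; apply: rpredB; apply: dhomogM => //; apply: der_homog.
Qed.

(** Since [l a] is prime and does not divide [l b], it divides [der t (l a)]. *)
Lemma cross_eq0_euler : cross t (l a) (l b) = 0 ->
  exists q : S, [/\ der t (l a) = q * l a, der t (l b) = q * l b & (msize q <= r)%N].
Proof.
move/subr0_eq => lab; have [_ _ aP] := form_prime a.
have [|/(form_ndivides ab)[]|[q qE]] := aP (l b) (der t (l a)).
  by rewrite -lab; exists (der t (l b)); rewrite mulrC.
exists q; split=> //.
  by apply: (mulfI (l0 a)); rewrite lab qE; ring.
have [->|q0] := eqVneq q 0; first by rewrite msize0.
have := msize_mul q0 (l0 a); rewrite -qE (msize_homog_neq0 (hl a)) //.
by have := msize_homog (der_homog a); lia.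
Qed.

(** Otherwise t - q E kills two independent forms vanishing at [P], hence equals
    s times the derivative along [P]. The forms off [P] then divide [s], so
    [residual_poly] divides [s], whose degree is too small: s = 0 and t = q E.
    As [t] kills [f] while E multiplies it by d, this gives t = 0. *)
Lemma cross_neq0 : (r < nlines A - mult A P)%N -> cross t (l a) (l b) != 0.
Proof.
move=> rd; apply/eqP => /cross_eq0_euler[q [qa qb qr]].
pose t' i : S := t i + (- q) * 'X_i.
have t'E k : der t' (l k) = der t (l k) - q * l k.
  by rewrite der_comb der_euler // mulNr.
have [c Pc] := coords_neq0 P.
have t'P i j : t' i * (coords P j)%:MP = t' j * (coords P i)%:MP.
  have [x [y xy]] := form_minor ab.
  have mpC_inj (z w : K) : z != w -> z%:MP_[3] != w%:MP.
    by apply: contra_neq => /(congr1 (mcoeff 0%MM)); rewrite !mpolyCK.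
  apply: (@common_zeros_parallel _ (fun i => (lcoef (l a) i)%:MP)
    (fun i => (lcoef (l b) i)%:MP) t' (fun i => (coords P i)%:MP) x y).
  - by rewrite -!mpolyCM; apply: mpC_inj.
  - by rewrite -der_lin // t'E qa subrr.
  - by rewrite -der_lin // t'E qb subrr.
  - by rewrite -der_lin // der_const //; move: Pa; rewrite through_eval => /eqP ->.
  - by rewrite -der_lin // der_const //; move: Pb; rewrite through_eval => /eqP ->.
(* The factor s for which t - q E is s times the derivative along [P]. *)
pose s : S := (coords P c)^-1 *: t' c.
have t's i : t' i = coords P i *: s.
  rewrite /s scalerA mulrC -scalerA -[coords P i *: _]mul_mpolyC mulrC -t'P.
  by rewrite mulrC mul_mpolyC scalerA mulVf // scale1r.
have sl k : der t' (l k) = (l k).@[coords P] *: s.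
  rewrite der_lin // lin_eval // scaler_suml; apply: eq_bigr => i _.
  by rewrite mul_mpolyC t's scalerA.
have ls : divides residual_poly s.
  apply: prod_forms_divides => k; rewrite through_eval => lk.
  have -> : s = (((l k).@[coords P])^-1)%:MP * der t' (l k).
    by rewrite mul_mpolyC sl scalerA mulVf // scale1r.
  rewrite t'E; apply/dividesMl/dividesB; first exact: log_of_syzygy.
  by exists q.
have szq : (msize (q * 'X_c) <= r.+1)%N.
  have [->|q0] := eqVneq q 0; first by rewrite mul0r msize0.
  have X0 : 'X_c != 0 :> S by rewrite -msize_poly_eq0 msizeX mdeg1.
  by have := msize_mul q0 X0; rewrite msizeX mdeg1; lia.
have szs : (msize s <= r.+1)%N.
  apply: leq_trans (msizeZ_le _ _) _; apply: leq_trans (msizeD_le _ _) _.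
  by rewrite geq_max msize_homog //= mulNr msizeN.
have s0 : s = 0.
  apply/eqP/negPn/negP => s0; have [z zE] := ls.
  have z0 : z != 0 by apply: contraNneq s0 => z0; rewrite zE z0 mul0r.
  have := msize_mul z0 residual_neq0; rewrite -zE.
  rewrite (msize_homog_neq0 residual_homog residual_neq0).
  by have := msize_gt0 z0; lia.
have t'0 i : t i = q * 'X_i.
  by apply/subr0_eq; rewrite -mulNr -/(t' i) t's s0 scaler0.
have [k /eqP[]] := tn0; rewrite t'0.
have d0 : (0 < nlines A)%N by apply: leq_ltn_trans (ltn_ord a).
have : q * ((nlines A)%:R * f) = 0.
  rewrite -tf -euler_defining_poly -der_mul.
  by apply: eq_bigr => i _; rewrite t'0.
move/eqP; rewrite -mpolyC_nat !mulf_eq0 mpolyC_eq0 ((pcharf0P K).1 char0).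
rewrite (negPf (_ : f != 0)); last by apply/prodf_neq0.
by rewrite eqn0Ngt d0 !orbF => /eqP ->; rewrite mul0r.
Qed.

(** Any form through [P] may replace [l a] or [l b] in [cross], at the cost of a
    constant factor. *)
Lemma pencil_divides_cross : divides pencil_poly (cross t (l a) (l b)).
Proof.
apply: prod_forms_divides => k Pk; have tk := log_of_syzygy k tf.
have lkk := divides_refl (l k).
have [x [y kE]] := pencil_comb ab Pa Pb Pk.
have lin_der : der t (l k) = x *: der t (l a) + y *: der t (l b).
  by rewrite kE der_linear.
have [y0|y0] := eqVneq y 0; last first.
  have -> : cross t (l a) (l b) = (y^-1)%:MP * (cross t (l a) (l k)).
    have -> : cross t (l a) (l k) = y *: cross t (l a) (l b).
      by rewrite /cross lin_der kE -!mul_mpolyC; ring.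
    by rewrite mul_mpolyC scalerA mulVf // scale1r.
  by apply/dividesMl/dividesB; [apply: dividesMl | apply: dividesMr].
have x0 : x != 0.
  by apply: contraNneq (l0 k) => x0; rewrite kE x0 y0 !scale0r addr0.
have -> : cross t (l a) (l b) = (x^-1)%:MP * (cross t (l k) (l b)).
  have -> : cross t (l k) (l b) = x *: cross t (l a) (l b).
    by rewrite /cross lin_der kE y0 !scale0r !addr0 -!mul_mpolyC; ring.
  by rewrite mul_mpolyC scalerA mulVf // scale1r.
by apply/dividesMl/dividesB; [apply: dividesMr | apply: dividesMl].
Qed.

End LowDegree.

(** This is modularity of the flat [P] in the intersection lattice. *)
Definition modular : Prop :=
  forall Q : point K, (2 <= mult A Q)%N ->
  exists2 k, through k & on_line Q (l k).

(** The case m = r + 1 is the interesting one: then [cross] is proportional to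
    [pencil_poly]. The value of [t] at an intersection point [Q] is tangent to two
    distinct lines through [Q], so it is proportional to [Q] and [cross] vanishes
    there, as does some form through [P]. *)
Lemma low_degree_syzygy r : (2 <= mult A P)%N ->
    (r < nlines A - mult A P)%N -> has_syzygy f r ->
  (mult A P <= r.+1)%N /\ (mult A P = r.+1 -> modular).
Proof.
move=> P2 rd [t0 [t1 [t2 [[h0 h1 h2] tn0 tf]]]].
pose t (i : 'I_3) : S := nth 0 [:: t0; t1; t2] i.
have {h0 h1 h2} th k : t k \is r.-homog by move: k; apply: forall_ord3.
have {}tn0 : exists k, t k != 0.
  apply: contrapT => nt; have {}nt k : t k = 0.
    by apply/eqP/negPn/negP => tk; apply: nt; exists k.
  by apply: tn0; split; [exact: (nt 0) | exact: (nt 1) | exact: (nt 2)].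
have {}tf : der t f = 0 by rewrite /der sum3.
have /card_gt1P[a [b [Pa Pb ab]]] : (1 < #|[pred i | through i]|)%N.
  by rewrite card_through.
have W0 := cross_neq0 th tn0 tf ab Pa Pb rd.
have := divides_homog (pencil_divides_cross tf ab Pa Pb) (cross_homog a b th) W0.
rewrite (msize_homog_neq0 pencil_homog pencil_neq0) => -[mr modP].
split=> [//|/(congr1 succn)/modP[c c0 WE] Q].
rewrite /mult => /card_gt1P[i [j []]]; rewrite !inE => Qi Qj ij.
suff : pencil_poly.@[coords Q] == 0.
  rewrite rmorph_prod /= => /prodf_eq0[k Pk].
  by rewrite -on_lineE // => Qk; exists k.
suff : (cross t (l a) (l b)).@[coords Q] == 0.
  by rewrite WE mevalZ mulf_eq0 (negPf c0).
(* The value of [t] at [Q], as a vector. *)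
pose T k := (t k).@[coords Q].
have TE k : on_line Q (l k) -> \sum_x lcoef (l k) x * T x = 0.
  rewrite on_lineE // => /eqP Qk; rewrite -lin_eval // -eval_der //.
  by have [q ->] := log_of_syzygy k tf; rewrite mevalM Qk mulr0.
have [x [y xy]] := form_minor ij.
have TQ : forall k k', T k * coords Q k' = T k' * coords Q k.
  by apply: common_zeros_parallel xy _ _ _ _; rewrite ?TE ?on_line_coords.
have [z Qz] := coords_neq0 Q.
have TQz k : T k = (T z / coords Q z) * coords Q k.
  by rewrite mulrAC -TQ mulfK.
have dE k : (der t (l k)).@[coords Q] = (T z / coords Q z) * (l k).@[coords Q].
  rewrite eval_der // !lin_eval // mulr_sumr; apply: eq_bigr => w _.
  by rewrite -/(T w) TQz mulrCA.
rewrite /cross mevalB !mevalM !dE mulrCA [X in _ - X]mulrCA.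
by rewrite [X in _ - _ * X]mulrC subrr.
Qed.

End Multiple.

(** * Logarithmic derivations at a modular point *)

Section Modular.
Variables (K : fieldType) (char0 : [pchar K] =i pred0).
Variables (A : arrangement K) (P : point K).
Local Notation S := {mpoly K[3]}.
Local Notation f := (defining_poly A).
Local Notation l := (@Defs.form K A).
Local Notation through := (@through K A P).
Local Notation g := (pencil_poly A P).
Implicit Types (p q u v : S) (t : 'I_3 -> S).

Let hl i : l i \is 1.-homog := form_homog i.
Let l0 i : l i != 0 := form_neq0 i.

Variables (a b : 'I_(nlines A)).
Hypotheses (ab : a != b) (Pa : through a) (Pb : through b).
Hypothesis modP : modular A P.

(** The product of the forms through [P] other than [l a], times the derivative
    along a vector on the line [l a] and off the line [l b]. *)
Lemma pencil_derivation : exists t c,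
  [/\ c != 0, forall i, through i -> divides (l i) (der t (l i)) &
      cross t (l a) (l b) = c *: g].
Proof.
have [i [j ij]] := form_minor ab.
(* The vector product of [l a] with a covector: it lies on the line [l a], and
   [l b] takes at it the value of a nonzero minor. *)
pose w k := lcoef (l a) j * (k == i)%:R - lcoef (l a) i * (k == j)%:R.
have wE k : (l k).@[w] = lcoef (l a) j * lcoef (l k) i - lcoef (l a) i * lcoef (l k) j.
  have sumE x : \sum_y lcoef (l k) y * (y == x)%:R = lcoef (l k) x.
    by rewrite (bigD1 x) //= eqxx mulr1 big1 ?addr0 // => y /negPf ->; rewrite mulr0.
  rewrite lin_eval // -(sumE i) -(sumE j) !mulr_sumr -sumrB.
  by apply: eq_bigr => y _; rewrite /w; ring.
pose g' := \prod_(k | through k && (k != a)) l k.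
pose t k := g' * (w k)%:MP.
have tE k : der t (l k) = (l k).@[w] *: g'.
  by rewrite der_mul der_const // mulrC mul_mpolyC.
have wa : (l a).@[w] = 0 by rewrite wE mulrC subrr.
exists t, (l b).@[w]; split.
- by rewrite wE subr_eq0 eq_sym.
- move=> k Pk; rewrite tE; have [->|ka] := eqVneq k a.
    by rewrite wa scale0r; apply: divides0.
  rewrite -mul_mpolyC /g' (bigD1 k) ?Pk //=.
  exact/dividesMl/dividesMr/divides_refl.
- by rewrite /cross !tE wa scale0r mulr0 subr0 /pencil_poly (bigD1 a) //= scalerAr.
Qed.

(** Given a field logarithmic along the lines through [P] and the lines [s], add a
    line [k] off [P] by subtracting a multiple of the product H of the forms in [s]
    times the derivative along [P]. This affects neither the forms through [P]
    nor the logarithmic condition along [s]; to achieve it along [k], the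
    restriction to [l k] of [der t (l k)] must be divisible by that of H
    ([sigma_prod_divides]). *)
Section AddLine.
Variables (t : 'I_3 -> S) (s : seq 'I_(nlines A)) (k : 'I_(nlines A)).
Hypotheses (us : uniq s) (ks : k \notin s) (nPk : ~~ through k).
Hypothesis (nPs : forall j, j \in s -> ~~ through j).
Hypothesis (tP : forall i, through i -> divides (l i) (der t (l i))).
Hypothesis (ts : forall i, i \in s -> divides (l i) (der t (l i))).

Variables (x0 : 'I_3) (kx0 : lcoef (l k) x0 != 0).
Local Notation sigma := (subst_line (l k) x0).

Lemma modular_relation j : j \in s -> exists i, through i /\
  exists c d, [/\ c != 0, d != 0 & l i = c *: l k + d *: l j].
Proof.
move=> js; have kj : k != j by apply: contraNneq ks => ->.
have [Q /andP[Qk Qj]] := lines_meet (hl k) (hl j) (l0 k) (l0 j).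
have [|i Pi Qi] := modP (Q := Q).
  by apply/card_gt1P; exists k, j; rewrite !inE.
have [x [y xy]] := form_minor kj.
have [c [d iE]] := concurrent_comb (hl i) (hl k) (hl j) xy Qi Qk Qj.
exists i; split=> //; exists c, d; split=> //.
- have ij : i != j by apply: contraTneq Pi => ->; apply: nPs.
  apply/eqP => c0; apply: (form_nonprop (c := d) ij).
  by rewrite iE c0 scale0r add0r.
- have ik : i != k by apply: contraTneq Pi => ->.
  apply/eqP => d0; apply: (form_nonprop (c := c) ik).
  by rewrite iE d0 scale0r addr0.
Qed.

Lemma sigma_homog j : sigma (l j) \is 1.-homog.
Proof.
rewrite subst_line_lin // -scaleNr -[X in X + _]scale1r.
exact: lin_comb.
Qed.

Lemma sigma_neq0 j : j \in s -> sigma (l j) != 0.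
Proof.
move=> js; have kj : k != j by apply: contraNneq ks => ->.
apply/eqP => /(divides_subst_line _ (hl k) kx0); exact: form_ndivides.
Qed.

Lemma sigma_prime j : j \in s -> prime_element (sigma (l j)).
Proof. by move=> js; apply: lin_prime (sigma_homog j) (sigma_neq0 js). Qed.

Lemma sigmaD p q : sigma (p + q) = sigma p + sigma q.
Proof. by rewrite /subst_line rmorphD. Qed.

Lemma sigmaZ c p : sigma (c *: p) = c *: sigma p.
Proof. by rewrite /subst_line linearZ. Qed.

Lemma sigma_k : sigma (l k) = 0.
Proof. exact: subst_line_id. Qed.

(** Proportional restrictions would make [l i] - c [l j] a multiple of [l k];
    it vanishes at [P], whereas [l k] does not. *)
Lemma sigma_through_nprop i j c : through i -> through j -> i != j ->
  sigma (l i) <> c *: sigma (l j).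
Proof.
move=> Pi Pj ij /eqP; rewrite -subr_eq0 -scaleNr -sigmaZ -sigmaD => /eqP.
move/(divides_subst_line _ (hl k) kx0).
have hij : l i + - c *: l j \is 1.-homog.
  by rewrite -[X in X + _]scale1r; apply: lin_comb.
case/(lin_divides_lin hij (hl k) (l0 k)) => e eE.
have := congr1 (meval (coords P)) eE; rewrite mevalD !mevalZ.
move: Pi Pj; rewrite !through_eval => /eqP -> /eqP ->; rewrite mulr0 addr0.
move/esym/eqP; rewrite mulf_eq0 -(through_eval P k) (negPf nPk) orbF => /eqP e0.
move: eE; rewrite e0 scale0r scaleNr => /subr0_eq.
exact: form_nonprop.
Qed.

(** The lines of [r] meet the line [k] in a single point, on the line [i] through
    [P], so their restrictions are all proportional and the product is a genuine
    power. The multiplicity comes from working before restriction: writing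
    der t (l i) = q l i, the Euler correction t - q E kills [l i] and
    remains logarithmic along [r]; as [l k] is a combination of [l i] and [l j],
    each [l j] divides der t (l k) - q (l k), and so does their product, being a
    product of distinct primes. The term q (l k) restricts to 0. *)
Lemma sigma_class_divides i (r : seq 'I_(nlines A)) : uniq r -> through i ->
    (forall j, j \in r -> j \in s /\
       exists c d, [/\ c != 0, d != 0 & l i = c *: l k + d *: l j]) ->
  divides (\prod_(j <- r) sigma (l j)) (sigma (der t (l k))).
Proof.
move=> ur Pi rP; have [q qE] := tP Pi.
suff [e eE] : divides (\prod_(j <- r) l j) (der t (l k) - q * l k).
  exists (sigma e); rewrite -subst_line_prod -subst_lineM -eE.
  by rewrite subst_lineB subst_lineM sigma_k mulr0 subr0.
apply: prod_primes_divides => // [j _|j j' _ _|j jr].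
- exact: form_prime.
- exact: form_ndivides.
have [js [c [d [c0 d0 iE]]]] := rP j jr.
have -> : der t (l k) - q * l k =
    (c^-1)%:MP * (d%:MP * (q * l j - der t (l j))).
  have : der t (l i) = c *: der t (l k) + d *: der t (l j).
    by rewrite iE der_linear.
  rewrite qE iE -!mul_mpolyC => E.
  have -> : d%:MP * (q * l j - der t (l j)) = c%:MP * (der t (l k) - q * l k).
    apply/eqP; rewrite -subr_eq0; apply/eqP; move/eqP: E; rewrite -subr_eq0.
    by move/eqP => <-; ring.
  by rewrite mulrA -mpolyCM mulVf // mul1r.
apply/dividesMl/dividesMl/dividesB; last exact: ts.
exact/dividesMl/divides_refl.
Qed.

(** Group the lines of [s] according to the line through [P] that passes through
    their intersection with the line [k], which exists by modularity; distinct
    groups have coprime restrictions. *)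
Lemma sigma_prod_divides : divides (\prod_(j <- s) sigma (l j)) (sigma (der t (l k))).
Proof.
have [m mP] : exists m : 'I_(nlines A) -> 'I_(nlines A), forall j, j \in s ->
    through (m j) /\
    exists c d, [/\ c != 0, d != 0 & l (m j) = c *: l k + d *: l j].
  have /choice[m mP] : forall j, exists i, j \in s -> through i /\
      exists c d, [/\ c != 0, d != 0 & l i = c *: l k + d *: l j].
    move=> j; have [js|_] := boolP (j \in s); last by exists j.
    by have [i iP] := modular_relation js; exists i.
  by exists m.
rewrite (partition_big m xpredT) //=.
apply: prod_coprime_divides => [|i _|i i' e _ _ ii'].
- exact: index_enum_uniq.
- rewrite -big_filter; have [Pi|nPi] := boolP (through i).
    apply: (sigma_class_divides (i := i)); rewrite ?filter_uniq // => j.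
    by rewrite mem_filter => /andP[/eqP <-] js; have [_ ?] := mP j js.
  rewrite big_seq big_pred0 => [|j].
    by exists (sigma (der t (l k))); rewrite mulr1.
  rewrite mem_filter; apply/negP => /andP[/eqP ji js].
  by have [+ _] := mP j js; rewrite ji (negPf nPi).
rewrite -[X in divides X]big_filter -[X in divides _ (X * _)]big_filter.
apply: prod_primes_cancel => j.
  by rewrite mem_filter => /andP[_]; apply: sigma_prime.
rewrite mem_filter => /andP[/eqP ji js].
apply: dvd_prime_prod (sigma_prime js) _ => j'.
rewrite mem_filter => /andP[/eqP ji' js'].
case/(lin_divides_lin (sigma_homog j') (sigma_homog j) (sigma_neq0 js)) => e' e'E.
have [Pi [c [d [c0 d0]]]] := mP j js.
have [Pi' [c' [d' [c'0 d'0]]]] := mP j' js'.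
rewrite ji in Pi *; rewrite ji' in Pi' * => iE' iE.
apply: (@sigma_through_nprop i' i (d' * e' / d)) => //; first by rewrite eq_sym.
rewrite iE iE' !sigmaD !sigmaZ sigma_k !scaler0 !add0r e'E !scalerA.
by congr (_ *: _); field.
Qed.

Lemma add_line : exists t', [/\ forall i, through i -> divides (l i) (der t' (l i)),
  forall i, i \in k :: s -> divides (l i) (der t' (l i)) &
  cross t' (l a) (l b) = cross t (l a) (l b)].
Proof.
have [e eE] := sigma_prod_divides.
pose H := \prod_(j <- s) l j; pose y := (l k).@[coords P].
have y0 : y != 0 by rewrite -(through_eval P k).
pose t' i := t i + (- (y^-1 *: (e * H))) * (coords P i)%:MP.
have t'E i : der t' (l i) = der t (l i) - ((l i).@[coords P] / y) *: (e * H).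
  by rewrite der_comb der_const // mulrC mul_mpolyC scalerN scalerA.
have t'P i : through i -> der t' (l i) = der t (l i).
  by rewrite t'E through_eval => /eqP ->; rewrite mul0r scale0r subr0.
exists t'; split=> [i Pi|i|]; first by rewrite t'P //; apply: tP.
- rewrite inE => /orP[/eqP -> {i}|js]; last first.
    rewrite t'E; apply: dividesB; first exact: ts.
    rewrite -mul_mpolyC /H (big_rem i) //=.
    exact/dividesMl/dividesMl/dividesMr/divides_refl.
  rewrite t'E divff // scale1r.
  have -> : der t (l k) - e * H = (der t (l k) - sigma (der t (l k))) -
      e * (H - sigma H) by rewrite eE subst_line_prod; ring.
  by apply/dividesB/dividesMl; apply: subst_line_mod.
by rewrite /cross !t'P.
Qed.

End AddLine.

Lemma modular_derivation (s : seq 'I_(nlines A)) : uniq s ->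
    (forall j, j \in s -> ~~ through j) ->
  exists t c, [/\ c != 0, forall i, through i -> divides (l i) (der t (l i)),
    forall i, i \in s -> divides (l i) (der t (l i)) &
    cross t (l a) (l b) = c *: g].
Proof.
elim: s => [_ _|k s IHs /= /andP[ks us] nP].
  by have [t [c [c0 tP tab]]] := pencil_derivation; exists t, c; split.
have nPs j : j \in s -> ~~ through j by move=> js; apply: nP; rewrite inE js orbT.
have [t [c [c0 tP ts tab]]] := IHs us nPs.
have [x0 kx0] := lin_neq0 (hl k) (l0 k).
have nPk := nP k (mem_head _ _).
have [t' [t'P t's t'ab]] := add_line us ks nPk nPs tP ts kx0.
by exists t', c; split=> //; rewrite t'ab.
Qed.

Lemma syzygy_of_modular : has_syzygy f (mult A P).-1.
Proof.
have [|j|t [c [c0 tP ts tab]]] := @modular_derivation (enum [pred j | ~~ through j]).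
- exact: enum_uniq.
- by rewrite mem_enum.
have P2 : (0 < mult A P)%N.
  by rewrite -card_through; apply/card_gt0P; exists a.
apply: (syzygy_of_log char0 (t := t) (u := l a) (v := l b)) => //.
- exact: leq_ltn_trans (ltn_ord a).
- move=> i; have [|nPi] := boolP (through i); first exact: tP.
  by apply: ts; rewrite mem_enum.
- by rewrite tab prednK //; apply: dhomogZ; apply: pencil_homog.
- by rewrite tab scaler_eq0 negb_or c0 pencil_neq0.
Qed.

End Modular.

(** * Modularity from the multiplicities of the intersection points *)

Section Counting.
Variables (K : fieldType) (A : arrangement K).
Local Notation l := (@Defs.form K A).
Local Notation ip := (intersection_points A).
Local Open Scope nat_scope.
Implicit Types (P Q : point K) (i j : 'I_(nlines A)).

Lemma sum_bool_card (I : finType) (X : pred I) : \sum_i (X i : nat) = #|X|.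
Proof.
rewrite -sum1_card [RHS]big_mkcond; apply: eq_bigr => i _.
by rewrite unfold_in; case: (X i).
Qed.

Lemma intersection_points_uniq : uniq ip.
Proof. exact: undup_uniq. Qed.

Lemma mem_ip i j Q : i != j -> on_line Q (l i) -> on_line Q (l j) -> Q \in ip.
Proof.
move=> ij Qi Qj; rewrite mem_intersection_points; apply/card_gt1P.
by exists i, j; rewrite !inE.
Qed.

Lemma forms_meet_once i j : i != j ->
  \sum_(Q <- ip) (on_line Q (l i) && on_line Q (l j) : nat) = 1.
Proof.
move=> ij; have hl k : l k \is 1.-homog := form_homog k.
have [Q /andP[Qi Qj]] := lines_meet (hl i) (hl j) (form_neq0 i) (form_neq0 j).
have [x [y xy]] := form_minor ij.
rewrite (bigD1_seq Q) ?intersection_points_uniq ?(mem_ip ij) //= Qi Qj.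
rewrite big1 ?addn0 // => R RQ; apply/eqP; rewrite eqb0; apply: contra RQ.
case/andP=> Ri Rj; apply/eqP.
exact: two_lines_point (hl i) (hl j) xy Ri Rj Qi Qj.
Qed.

Lemma sum_pairs (I : finType) (X : pred I) :
  \sum_i \sum_(j | i != j) (X i && X j : nat) = #|X| * #|X|.-1.
Proof.
rewrite -{1}(sum_bool_card X) big_distrl /=; apply: eq_bigr => i _.
case: (boolP (X i)) => [Xi|_]; last by rewrite big1.
rewrite mul1n (cardD1 i X) [i \in X]Xi /= -sum_bool_card big_mkcond /=.
by apply: eq_bigr => j _ /=; rewrite eq_sym; case: eqP.
Qed.

Lemma sum_mult_pairs :
  \sum_(Q <- ip) mult A Q * (mult A Q).-1 = nlines A * (nlines A).-1.
Proof.
pose on Q i := on_line Q (l i).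
have multE Q : mult A Q = #|[pred i | on Q i]| by apply: eq_card => i; rewrite !inE.
under eq_bigr => Q _ do rewrite multE -sum_pairs /=.
rewrite exchange_big /=.
under eq_bigr => i _ do rewrite exchange_big /=.
have := sum_pairs (pred_of_simpl (@predT 'I_(nlines A))).
rewrite card_ord => <-.
by apply: eq_bigr => i _; apply: eq_bigr => j ij; rewrite forms_meet_once.
Qed.

(** A line through [P] and a line off [P] meet in one point Q distinct from [P],
    and Q lies on at most one line through [P]. When there is one, exactly
    mult Q - 1 lines through Q avoid [P], so such pairs are counted by mult Q - 1. *)
Lemma sum_mult_pencil P : 2 <= mult A P ->
  \sum_(Q <- ip) (mult A Q).-1 =
    (mult A P).-1 + mult A P * (nlines A - mult A P) +
    \sum_(Q <- ip | [forall i, through P i ==> ~~ on_line Q (l i)])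
       (mult A Q).-1.
Proof.
move=> P2; pose T i := through P i.
(* The numbers of lines through [Q] that contain, resp. avoid, [P]. *)
pose a Q := \sum_(i | T i) (on_line Q (l i) : nat).
pose b Q := \sum_(j | ~~ T j) (on_line Q (l j) : nat).
have abE Q : mult A Q = a Q + b Q.
  rewrite /a /b -(bigID T xpredT (fun i => on_line Q (l i) : nat)) /=.
  by rewrite sum_bool_card; apply: eq_card => i; rewrite !inE.
have Pip : P \in ip by rewrite mem_intersection_points.
have sum_ab : \sum_(Q <- ip) a Q * b Q = mult A P * (nlines A - mult A P).
  under eq_bigr => Q _ do rewrite /a /b big_distrlr /=.
  rewrite exchange_big /=.
  transitivity (\sum_(i | T i) \sum_(j | ~~ T j) 1).
    apply: eq_bigr => i Ti; rewrite exchange_big /=; apply: eq_bigr => j Tj.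
    rewrite -(@forms_meet_once i j); last by apply: contraTneq Ti => ->.
    by apply: eq_bigr => Q _; rewrite mulnb.
  under eq_bigr => i _ do rewrite sum1_card card_residual.
  by rewrite sum_nat_const card_through.
have bP : b P = 0 by apply: big1 => j nTj; apply/eqP; rewrite eqb0.
have aP : a P = mult A P by rewrite abE bP addn0.
have a0 Q : [forall i, T i ==> ~~ on_line Q (l i)] = (a Q == 0).
  rewrite sum_nat_eq0; apply: eq_forallb => i.
  by rewrite eqb0.
have a1 Q : Q != P -> a Q <= 1.
  move=> QP; rewrite leqNgt; apply/negP => aQ; case/eqP: QP.
  have : 1 < #|[pred i | T i && on_line Q (l i)]|.
    rewrite -sum_bool_card (bigID T) /= [X in _ < _ + X]big1 ?addn0 => [|i /negPf -> //].
    by move: aQ; rewrite /a; under eq_bigr => i Ti do rewrite -[on_line _ _]andTb -{1}Ti.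
  case/card_gt1P=> i [j []]; rewrite !inE => /andP[Ti Qi] /andP[Tj Qj] ij.
  have [x [y xy]] := form_minor ij.
  exact: two_lines_point (form_homog i) (form_homog j) xy Qi Qj Ti Tj.
rewrite -sum_ab [X in _ = _ + X]big_mkcond /=.
have -> : (mult A P).-1 = \sum_(Q <- ip) (if Q == P then (mult A P).-1 else 0).
  rewrite (bigD1_seq P) ?intersection_points_uniq //= eqxx big1 ?addn0 //.
  by move=> Q /negPf ->.
rewrite -!big_split /=; apply: eq_bigr => Q _; rewrite a0.
have [->|QP] := eqVneq Q P.
  by rewrite bP muln0 addn0 aP; case: eqP => [->|_]; rewrite ?addn0.
by have := a1 Q QP; rewrite abE; case: (a Q) => [|[|//]] _; rewrite ?mul1n ?addn0.
Qed.

Lemma modular_sum P : 2 <= mult A P ->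
  modular A P <->
  \sum_(Q <- ip) (mult A Q).-1 =
    (mult A P).-1 + mult A P * (nlines A - mult A P).
Proof.
move=> P2; rewrite (sum_mult_pencil P2); split=> [modP|].
  rewrite big_seq_cond big1 ?addn0 // => Q /andP[].
  rewrite mem_intersection_points => /modP[i Pi Qi] /forallP/(_ i).
  by rewrite Pi Qi.
move/eqP; rewrite -[X in _ == X]addn0 eqn_add2l sum_nat_seq_eq0 => /allP e0 Q Q2.
have := e0 Q; rewrite mem_intersection_points => /(_ Q2) /implyP.
have [i /andP[Pi Qi] _|nQ] := pickP [pred i | through P i && on_line Q (l i)].
  by exists i.
have nI : [forall i, through P i ==> ~~ on_line Q (l i)].
  by apply/forallP => i; have := nQ i => /=; case: (through P i) => //= ->.
by rewrite nI => /(_ isT); case: (mult A Q) Q2 => [|[]].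
Qed.

End Counting.

(** * The minimal degree of a syzygy *)

Section MaximalMultiplicity.
Variables (K : fieldType) (A : arrangement K).
Local Notation l := (@Defs.form K A).
Local Notation ip := (intersection_points A).
Implicit Types (P Q : point K) (i j : 'I_(nlines A)).

(** An arrangement of at most one line is not essential,
    so some intersection point exists and the maximum is attained. *)
Lemma essential_max_mult : essential A ->
  exists2 P, (2 <= mult A P)%N & mult A P = max_mult A.
Proof.
move=> ess; have hl k : l k \is 1.-homog := form_homog k.
have l0 k : l k != 0 := form_neq0 k.
have [i [j ij]] : exists i j, i != j.
  apply: contrapT => nij; apply: ess.
  have [i|] := pickP (@predT 'I_(nlines A)).
    have [P /andP[Pi _]] := lines_meet (hl i) (hl i) (l0 i) (l0 i).
    exists P => k; have [<- //|ik] := eqVneq i k.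
    by exfalso; apply: nij; exists i, k.
  move=> no; have hX : 'X_0 \is [in K[3], 1.-homog] by rewrite dhomogX /= mdeg1.
  have X0 : 'X_0 != 0 :> {mpoly K[3]} by rewrite -msize_poly_eq0 msizeX mdeg1.
  by have [P _] := lines_meet hX hX X0 X0; exists P => k; have := no k.
have [Q /andP[Qi Qj]] := lines_meet (hl i) (hl j) (l0 i) (l0 j).
have Qip := mem_ip ij Qi Qj; apply: contrapT => nP.
have maxQ R : R \in ip -> (mult A R <= max_mult A)%N.
  by move=> Rip; rewrite /max_mult (big_rem R) //= leq_maxl.
have : (max_mult A <= (max_mult A).-1)%N.
  apply/bigmax_leqP_seq => R Rip _; have := maxQ R Rip.
  rewrite leq_eqVlt => /orP[/eqP RE|]; last by case: (max_mult A).
  by case: nP; exists R; rewrite // -mem_intersection_points.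
by have := maxQ Q Qip; move: Qip; rewrite mem_intersection_points; lia.
Qed.

Lemma essential_lines P : essential A -> (2 <= mult A P)%N ->
  exists i j, through P i /\ ~~ through P j.
Proof.
move=> ess /(leq_trans (leqnSn 1))/card_gt0P[i]; rewrite inE => Pi.
exists i; apply: contrapT => nj; apply: ess; exists P => j.
by apply/negPn/negP => Pj; apply: nj; exists j.
Qed.

(** The sum condition is modularity of a point of maximal multiplicity
    ([modular_sum]); the right-hand side depends only on the list of multiplicities
    and on the number of lines. *)
Lemma min_syzygy_degreeE : [pchar K] =i pred0 -> essential A ->
    (nlines A <= 2 * max_mult A)%N ->
  min_syzygy_degree A =
    if (nlines A == 2 * max_mult A)%N &&
       (\sum_(Q <- ip) (mult A Q).-1 ==
        (max_mult A).-1 + max_mult A * (nlines A - max_mult A))%N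
    then (max_mult A).-1 else (nlines A - max_mult A)%N.
Proof.
move=> char0 ess; have [P P2 <-] := essential_max_mult ess => dm.
have [i [j [Pi Pj]]] := essential_lines ess P2.
have [a [b [Pa Pb ab]]] :
    exists a b : 'I_(nlines A), [/\ through P a, through P b & a != b].
  move: P2; rewrite /mult => /card_gt1P[a [b []]]; rewrite !inE => Pa Pb ab.
  by exists a, b.
have low r := low_degree_syzygy char0 (r := r) P2.
rewrite /min_syzygy_degree; case: ex_minnP => r /asboolP hr minr.
have {}minr k : has_syzygy (defining_poly A) k -> (r <= k)%N.
  by move=> hk; apply/minr/asboolP.
have := minr _ (syzygy_of_residual char0 Pi Pj).
case: ifP => [/andP[/eqP d2 /eqP/(modular_sum P2) modP]|nmod].
  have := minr _ (syzygy_of_modular char0 ab Pa Pb modP).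
  rewrite d2 in low *; move=> rm _.
  have [rd|] := ltnP r (2 * mult A P - mult A P); last by lia.
  by have [mr _] := low r rd hr; lia.
rewrite leq_eqVlt => /orP[/eqP //|rd].
have [mr modP] := low r rd hr; case/negP: (negbT nmod).
have rm : mult A P = r.+1 by lia.
apply/andP; split; first by apply/eqP; lia.
by apply/eqP/modular_sum => //; apply: modP.
Qed.

End MaximalMultiplicity.

Lemma perm_multiplicities (K : fieldType) (A1 A2 : arrangement K) :
    same_weak_combinatorics A1 A2 ->
  perm_eq (map (mult A1) (intersection_points A1))
          (map (mult A2) (intersection_points A2)).
Proof.
move=> same; apply/allP => j; rewrite mem_cat !inE => j12.
have j2 : (2 <= j)%N.
  by case/orP: j12 => /mapP[Q Qip ->]; rewrite -mem_intersection_points.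
by rewrite /= !count_map; apply/eqP; apply: same.
Qed.

Theorem corollary3p8 (K : fieldType) (charK0 : [pchar K]%R =i pred0)
    (A1 A2 : arrangement K) (ess1 : essential A1) (ess2 : essential A2)
    (same : same_weak_combinatorics A1 A2)
    (big_mult : (nlines A1 <= 2 * max_mult A1)%N) :
  min_syzygy_degree A1 = min_syzygy_degree A2.
Proof.
have pm := perm_multiplicities same.
have sumE (F : nat -> nat) :
    (\sum_(Q <- intersection_points A1) F (mult A1 Q) =
     \sum_(Q <- intersection_points A2) F (mult A2 Q))%N.
  rewrite -(big_map (mult A1) xpredT F) -(big_map (mult A2) xpredT F).
  exact: perm_big.
have maxE : max_mult A1 = max_mult A2.
  rewrite /max_mult -(big_map (mult A1) xpredT id) -(big_map (mult A2) xpredT id).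
  exact: perm_big.
have linesE : nlines A1 = nlines A2.
  have := sumE (fun k => k * k.-1)%N; rewrite !sum_mult_pairs.
  (* The number d is determined by d (d - 1) only if it is positive. *)
  have [P1 P1m _] := essential_max_mult ess1.
  have [P2 P2m _] := essential_max_mult ess2.
  have lines2 (A : arrangement K) (P : point K) : (2 <= mult A P -> 2 <= nlines A)%N.
    by move/leq_trans; apply; rewrite /mult -[X in (_ <= X)%N]card_ord max_card.
  have := lines2 _ _ P1m; have := lines2 _ _ P2m.
  by case: (nlines A1) (nlines A2) => [|n] [|p] //= _ _; nia.
rewrite !min_syzygy_degreeE // -?maxE -?linesE //.
by rewrite (sumE predn).
Qed.
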